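(* Let $\mathbf q=\{q_1,q_2,\dots\}$ be (in general infinitely many) formal variables with positive integer degrees $a_k\in\mathbb Z_{>0}$, such that for every $0<n<\infty$ only finitely many variables $q_k$ have $a_k<n$. Let $E=\sum_k a_k q_k\frac{\partial}{\partial q_k}$, and for each $k\ge 1$ let $V_k$ be a differential operator of degree $k$ with coefficients given by formal series in the variables $\mathbf q$. Then the equation $$\Big(E-\sum_{k=1}^\infty k V_k\Big)\cdot Z(\mathbf q)=0$$ has a unique solution $Z(\mathbf q)\in\mathbb C[\![\mathbf q]\!]$ up to a normalization (that is, up to the choice of the constant term $Z(\mathbf 0)\in\mathbb C$).
   Context: Degrees: $\deg q_k=a_k$ and $\deg \frac{\partial}{\partial q_k}=-a_k$. An operator has degree $k$ if it is homogeneous and raises the degree by $k$, i.e. maps the homogeneous polynomials of degree $j$ to homogeneous polynomials of degree $j+k$. Since only finitely many variables have any given bounded degree, each homogeneous component of an element of $\mathbb C[\![\mathbf q]\!]$ is a polynomial, and operators of finite degree act on $\mathbb C[\![\mathbf q]\!]$ component by component. *)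

(* Defs.v *)
From HB Require Import structures.
From mathcomp Require Import all_boot all_order all_algebra finmap.
From mathcomp Require Import monalg complex.
From mathcomp Require Import mathcomp_extra boolp classical_sets functions.
From mathcomp Require Import cardinality fsbigop reals.

Set Implicit Arguments.
Unset Strict Implicit.
Unset Printing Implicit Defensive.

Import Order.TTheory GRing.Theory Num.Theory.

Local Open Scope classical_set_scope.
Local Open Scope ring_scope.

(* A monomial in the variables (q_i)_{i : I} is a finitely supported exponent
   function {cmonom I}, written multiplicatively: mone is the empty monomial,
   ucm i is q_i.  A formal series is the family of its coefficients.  All the
   sums \sum_(x \in A) below are finitely supported sums: they are 0 when
   infinitely many terms are nonzero. *)
Section FormalSeries.
Variables (K : comNzRingType) (I : choiceType).

Definition fps : Type := {cmonom I} -> K.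

Definition fps_var (i : I) : fps := fun m => (m == ucm i)%:R.

Definition fps_mul (f g : fps) : fps := fun m =>
  \sum_(p \in [set p : {cmonom I} * {cmonom I} | mmul p.1 p.2 = m])
    f p.1 * g p.2.

Definition fps_pderiv (i : I) (f : fps) : fps := fun m =>
  f (mmul m (ucm i)) *+ (m i).+1.

(* \prod_i (d/dq_i)^(al i) *)
Definition fps_deriv (al : {cmonom I}) (f : fps) : fps :=
  foldr (fun i => iter (al i) (fps_pderiv i)) f (finsupp al).

(* Coefficientwise sum of a sequence of series, indexed from 1. *)
Definition fps_sum (F : nat -> fps) : fps := fun m =>
  \sum_(k \in [set k : nat | (0 < k)%N]) F k m.

Definition is_polynomial (f : fps) := finite_set [set m | f m != 0].

(* D stands for the formal operator \sum_al D al * d^al; neither the order nor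
   the number of nonzero terms is required to be finite. *)
Definition diffop : Type := {cmonom I} -> fps.

(* Meaningful when f is a polynomial: then d^al f = 0 for all but finitely
   many al. *)
Definition diffop_poly (D : diffop) (f : fps) : fps := fun m =>
  \sum_(al \in [set: {cmonom I}]) fps_mul (D al) (fps_deriv al f) m.

Section Grading.
Variable a : I -> nat.

Definition wdeg (m : {cmonom I}) : nat :=
  (\sum_(i <- finsupp m) a i * m i)%N.

Definition is_homogeneous (j : nat) (f : fps) :=
  is_polynomial f /\ forall m, f m != 0 -> wdeg m = j.

Definition hcomp (j : nat) (f : fps) : fps := fun m =>
  if wdeg m == j then f m else 0.

Definition has_degree (D : diffop) (k : nat) := forall (j : nat) (f : fps),
  is_homogeneous j f -> is_homogeneous (j + k) (diffop_poly D f).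

(* Action of an operator of finite degree on a series, one homogeneous
   component at a time.  It cannot be replaced by diffop_poly D Z, where
   infinitely many al may contribute to one coefficient. *)
Definition diffop_act (D : diffop) (Z : fps) : fps := fun m =>
  \sum_(j \in [set: nat]) diffop_poly D (hcomp j Z) m.

(* \sum_i a_i q_i d/dq_i; the inner sum has at most one term. *)
Definition euler : diffop := fun al =>
  \sum_(i \in [set i | ucm i = al]) fps_var i *+ a i.

End Grading.
End FormalSeries.

(* Main.v *)
Require Import Defs.
From HB Require Import structures.
From mathcomp Require Import all_boot all_order all_algebra finmap.
From mathcomp Require Import monalg complex.
From mathcomp Require Import mathcomp_extra boolp classical_sets functions.
From mathcomp Require Import cardinality fsbigop reals.

(** In each weight [n], the Euler operator [E] acts as multiplication by [n],
    while [V k] maps the component of weight [n - k] to weight [n].  Hence the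
    equation reads [n Z_n = \sum_(1 <= k <= n) k V_k Z_(n - k)]: it is void for
    [n = 0] and determines [Z_n] from the lower components for [n > 0]. *)

Set Implicit Arguments.
Unset Strict Implicit.
Unset Printing Implicit Defensive.

Import Order.TTheory GRing.Theory Num.Theory.

Local Open Scope classical_set_scope.
Local Open Scope ring_scope.

(** Each application of [Phi] settles one more weight: from the [n]-th iterate on, the values at
    weights below [n] no longer change. Reading each [x] off the iterate [(w x).+1] thus gives a
    fixed point, and strong induction on the weight makes it the only one. *)
Lemma graded_recursion (X Y : Type) (w : X -> nat) (y0 : Y)
    (Phi : (X -> Y) -> X -> Y) :
  (forall f g x, (forall y, (w y < w x)%N -> f y = g y) -> Phi f x = Phi g x) ->
  exists! f : X -> Y, forall x, f x = Phi f x.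
Proof.
move=> PhiP; pose f0 n := iter n Phi (fun=> y0).
have f0E n p x : (w x < n)%N -> (w x < p)%N -> f0 n x = f0 p x.
  elim: n p x => // n IHn [|p] x //= xn xp; apply: PhiP => y yx.
  by apply: IHn; exact: leq_trans yx _.
exists (fun x => f0 (w x).+1 x); split=> [x|g gE].
  by apply: PhiP => y yx; exact: f0E.
apply/funext => x; have [n] := ubnP (w x); elim: n x => // n IHn x xn.
rewrite [RHS]gE; apply: PhiP => y yx.
rewrite -IHn; first exact: f0E.
exact: leq_trans yx xn.
Qed.

Lemma fsbig_single (V : nmodType) (T : choiceType) (A : set T) (x : T)
    (f : T -> V) :
  A x -> (forall y, A y -> y != x -> f y = 0) -> \sum_(y \in A) f y = f x.
Proof.
move=> Ax f0; rewrite -[RHS](@fsbig_set1 _ 0 +%R _ x f); apply/esym/fsbig_widen.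
  by move=> y ->.
by move=> y [Ay /eqP yx]; exact: f0.
Qed.

Section Monomials.
Variables (I : choiceType) (a : I -> nat).
Implicit Types m : {cmonom I}.

Lemma wdegEw m (d : {fset I}) : (finsupp m `<=` d)%fset ->
  wdeg a m = (\sum_(i <- d) a i * m i)%N.
Proof.
move=> le; rewrite /wdeg (big_fset_incl _ le) // => i _.
by rewrite -cmE_eq0 => /eqP ->; rewrite muln0.
Qed.

Lemma wdegM m1 m2 : wdeg a (mmul m1 m2) = (wdeg a m1 + wdeg a m2)%N.
Proof.
rewrite {1}/wdeg mdomD (wdegEw (fsubsetUl _ (finsupp m2))).
rewrite (wdegEw (fsubsetUr (finsupp m1) _)) -big_split /=.
by apply: eq_bigr => i _; rewrite cmM mulnDr.
Qed.

Lemma wdegU i : wdeg a (ucm i) = a i.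
Proof. by rewrite /wdeg mdomU big_seq_fset1 cmUU muln1. Qed.

Lemma wdeg1 : wdeg a mone = 0%N.
Proof. by rewrite /wdeg mdom1 big_seq_fset0. Qed.

Lemma ucm_inj : injective (@ucm I).
Proof.
move=> i j /(congr1 (fun m : {cmonom I} => m j)); rewrite cmUU cmU.
by case: eqVneq.
Qed.

Lemma mmulI m : injective (mmul m).
Proof.
move=> m1 m2 /eqP/cmP e; apply/eqP/cmP => i; apply/eqP.
by move: (e i); rewrite !cmM => /eqP; rewrite eqn_add2l.
Qed.

Lemma cmonom_divU m i : (0 < m i)%N -> exists m', m = mmul (ucm i) m'.
Proof.
move=> mi; exists (divcm m (ucm i)); apply/eqP/cmP => j.
rewrite cmM divcmE cmU; case: eqVneq => [<-|_] /=; last by rewrite subn0.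
by rewrite subnKC.
Qed.

Lemma cmonom_neq1 m : m != mone -> exists i, (0 < m i)%N.
Proof.
move=> m1; apply: contrapT => m0; move/negP: m1; apply; apply/cmP => i.
by rewrite cm1; apply/eqP; rewrite eqn0Ngt; apply/negP => mi; apply: m0; exists i.
Qed.

Hypothesis a_gt0 : forall i, (0 < a i)%N.

Lemma wdeg_eq0 m : (wdeg a m == 0%N) = (m == mone).
Proof.
apply/idP/eqP => [|->]; last by rewrite wdeg1.
apply: contraTeq => /cmonom_neq1[i /cmonom_divU[m' ->]].
by rewrite wdegM wdegU addn_eq0 negb_and -lt0n a_gt0.
Qed.

Hypothesis a_fin :
  forall n : nat, (0 < n)%N -> finite_set [set i : I | (a i < n)%N].

(** A nontrivial monomial of weight at most [n] is [ucm i] times some [m']. There are finitely many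
    such [i], since [a i <= n], and [m'] has weight below [n], since [a i >= 1]. *)
Lemma finite_wdeg_lt n : finite_set [set m | (wdeg a m < n)%N].
Proof.
elim: n => [|n IHn]; first by rewrite (_ : mkset _ = set0) // -subset0.
apply: (@sub_finite_set _ _ ([set mone] `|` [set mmul x y | x in
    @ucm I @` [set i | (a i < n.+1)%N] & y in [set m | (wdeg a m < n)%N]])).
  move=> m /= mn; have [->|/cmonom_neq1[i /cmonom_divU[m' mE]]] := eqVneq m mone.
    by left.
  move: mn; rewrite mE wdegM wdegU => mn; right.
  exists (ucm i); first by exists i => //=; exact: leq_ltn_trans (leq_addr _ _) mn.
  exists m' => //=; rewrite -ltnS; apply: leq_trans mn.
  by rewrite ltnS -add1n leq_add2r.
rewrite finite_setU; split; first exact: finite_set1.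
by apply: finite_image2 => //; apply: finite_image; exact: a_fin.
Qed.

(** Lets [has_degree], which speaks of polynomials only, be applied to the components of any
    series. *)
Lemma hcomp_homogeneous (K : comNzRingType) j (f : fps K I) :
  is_homogeneous a j (hcomp a j f).
Proof.
split; last by move=> m; rewrite /hcomp; case: (wdeg a m =P j) => // _; rewrite eqxx.
apply: sub_finite_set (finite_wdeg_lt j.+1) => m /=; rewrite /hcomp.
by case: (wdeg a m =P j) => [->|_]; rewrite ?eqxx.
Qed.

(** Only the component of weight [j] with [j + k = wdeg a m] can reach [m]. The test [k <= wdeg a m]
    is needed because the truncated difference would otherwise select weight 0. *)
Lemma diffop_act_degree (K : comNzRingType) (D : diffop K I) k (Z : fps K I) m :
  has_degree a D k ->
  diffop_act a D Z m =
    if (k <= wdeg a m)%N then diffop_poly D (hcomp a (wdeg a m - k) Z) m else 0.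
Proof.
move=> Dk; rewrite /diffop_act.
have D0 j : wdeg a m != (j + k)%N -> diffop_poly D (hcomp a j Z) m = 0.
  move=> mjk; apply/eqP; apply: contraNT mjk => /(Dk j _ _).2 -> //.
  exact: hcomp_homogeneous.
case: leqP => km.
  apply: fsbig_single => // j _ jm; apply: D0; apply: contra_neq jm => ->.
  by rewrite addnK.
apply: fsbig1 => j _; apply: D0; apply: contraTneq km => ->.
by rewrite -leqNgt leq_addl.
Qed.

End Monomials.

Section Euler.
Variables (K : comNzRingType) (I : choiceType) (a : I -> nat).
Implicit Types (f g : fps K I) (m : {cmonom I}).

Lemma fps_deriv_ucm i f : fps_deriv (ucm i) f = fps_pderiv i f.
Proof.
rewrite /fps_deriv mdomU (_ : enum_fset [fset i]%fset = [:: i]) /= ?cmUU //.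
(* A permutation of a one-element list is that list, so comparing members suffices. *)
apply: perm_small_eq => //; apply: uniq_perm => // j.
by rewrite inE mem_seq1.
Qed.

Lemma euler_ucm i : euler K a (ucm i) = fps_var K i *+ a i.
Proof.
by rewrite /euler (fsbig_single (x := i)) // => j /ucm_inj -> /eqP.
Qed.

Lemma euler_eq0 al : (forall i, ucm i <> al) -> euler K a al = 0.
Proof. by move=> al_neq; apply: fsbig1 => i /al_neq. Qed.

Lemma fps_mul_var i n f m :
  fps_mul (fps_var K i *+ n) (fps_pderiv i f) m = f m *+ (n * m i).
Proof.
rewrite /fps_mul /fps_var /fps_pderiv natmulfctE.
(* If [q_i] does not divide [m], no factorization of [m] starts with [ucm i]; otherwise exactly one
   does. *)
have [mi|] := posnP (m i).
  rewrite mi muln0 mulr0n; apply: fsbig1 => -[p q] /= pq.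
  have [pi|_] := eqVneq p (ucm i); last by rewrite mul0rn mul0r.
  by move: mi; rewrite -pq pi cmM cmUU.
move=> /cmonom_divU[m' ->].
rewrite (fsbig_single (x := (ucm i, m'))) //=.
  (* The derivative contributes [(m' i).+1], the exponent of [i] in [mmul (ucm i) m']. *)
  by rewrite eqxx mulrC mulr_natr -mulrnA cmM cmUU mulnC mulmC.
move=> [p q] /= pq; have [pi|_] := eqVneq p (ucm i); last by rewrite mul0rn mul0r.
by move: pq; rewrite pi => /mmulI ->; rewrite eqxx.
Qed.

(** This holds for every series [f], polynomial or not: only the indices [al = ucm i] carry a
    coefficient, and among them only those with [i] in the support of [m] contribute at [m]. *)
Lemma diffop_poly_euler f m : diffop_poly (euler K a) f m = f m *+ wdeg a m.
Proof.
rewrite /diffop_poly.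
rewrite -(@fsbig_widen _ _ _ _ (@ucm I @` [set: I])) //=; last first.
  move=> al [_ alN] /=; rewrite euler_eq0 => [|i ial].
    by apply: fsbig1 => p _; rewrite mul0r.
  by apply: alN; exists i.
rewrite fsbig_image; last by move=> i j _ _; exact: ucm_inj.
under eq_fsbigr => i _ do rewrite fps_deriv_ucm euler_ucm fps_mul_var.
rewrite (fsbigTE (finsupp m)); first by rewrite /wdeg -sumrMnr.
by move=> i; rewrite -cmE_eq0 => /eqP ->; rewrite muln0.
Qed.

Lemma diffop_act_euler f m : diffop_act a (euler K a) f m = f m *+ wdeg a m.
Proof.
rewrite /diffop_act; under eq_fsbigr => j _ do rewrite diffop_poly_euler /hcomp.
rewrite (fsbig_single (x := wdeg a m)) ?eqxx // => j _ /negPf.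
by rewrite eq_sym => ->; rewrite mul0rn.
Qed.

End Euler.

(** Operators with [k > wdeg a m] raise the weight past that of [m], so the infinite sum is finite
    at each monomial. *)
Lemma fps_sum_degree (K : comNzRingType) (I : choiceType) (a : I -> nat)
    (a_gt0 : forall i, (0 < a i)%N)
    (a_fin : forall n : nat, (0 < n)%N -> finite_set [set i : I | (a i < n)%N])
    (V : nat -> diffop K I)
    (V_deg : forall k : nat, (0 < k)%N -> has_degree a (V k) k)
    (Z : fps K I) m :
  fps_sum (fun k => diffop_act a (V k) Z *+ k) m =
  \sum_(1 <= k < (wdeg a m).+1)
    diffop_poly (V k) (hcomp a (wdeg a m - k) Z) m *+ k.
Proof.
have actE k : (0 < k)%N -> (diffop_act a (V k) Z *+ k) m =
    if (k <= wdeg a m)%N then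
      diffop_poly (V k) (hcomp a (wdeg a m - k) Z) m *+ k else 0.
  move=> k0; rewrite natmulfctE (diffop_act_degree a_gt0 a_fin _ _ (V_deg k k0)).
  by case: ifP; rewrite ?mul0rn.
rewrite /fps_sum (fsbigE (index_iota 1 (wdeg a m).+1)) ?iota_uniq //=.
- rewrite big_seq_cond [RHS]big_seq_cond; apply: eq_big => k.
    rewrite mem_index_iota; case: (posnP k) => [->//|k0].
    by rewrite [k \in _]mem_set // andbT.
  by rewrite mem_index_iota => /andP[/andP[k0 km] _]; rewrite actE // -ltnS km.
- by move=> k /=; rewrite mem_index_iota => /andP[].
- move=> k k0; rewrite mem_index_iota k0 /= ltnS => /negPf km.
  by rewrite actE // km.
Qed.

Theorem proposition2p1 (R : realType) (I : countType) (a : I -> nat)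
    (a_gt0 : forall i : I, (0 < a i)%N)
    (a_fin : forall n : nat, (0 < n)%N -> finite_set [set i : I | (a i < n)%N])
    (V : nat -> diffop R[i] I)
    (V_deg : forall k : nat, (0 < k)%N -> has_degree a (V k) k)
    (c : R[i]) :
  exists! Z : fps R[i] I,
    Z mone = c /\
    diffop_act a (euler R[i] a) Z
      - fps_sum (fun k : nat => diffop_act a (V k) Z *+ k) = 0.
Proof.
pose rhs (Z : fps R[i] I) m := \sum_(1 <= k < (wdeg a m).+1)
    diffop_poly (V k) (hcomp a (wdeg a m - k) Z) m *+ k.
(* The equation solved for [Z m]: positive degrees make [mone] the only monomial of weight 0, and
   elsewhere the weight is invertible in characteristic 0. *)
pose Phi (Z : fps R[i] I) m :=
  if m == mone then c else rhs Z m / (wdeg a m)%:R.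
have PhiP (Z : fps R[i] I) : (Z mone = c /\
    diffop_act a (euler R[i] a) Z
      - fps_sum (fun k : nat => diffop_act a (V k) Z *+ k) = 0) <->
    (forall m, Z m = Phi Z m).
  have eqE : diffop_act a (euler R[i] a) Z
        - fps_sum (fun k : nat => diffop_act a (V k) Z *+ k) = 0 <->
      forall m, Z m * (wdeg a m)%:R = rhs Z m.
    split=> [/(congr1 (fun f : fps R[i] I => f _)) E m|E].
      move: (E m); rewrite -[LHS]/(_ m - _ m) diffop_act_euler.
      by rewrite (fps_sum_degree a_gt0) // mulr_natr => /eqP; rewrite subr_eq0 =>
        /eqP.
    apply/funext => m; rewrite -[LHS]/(_ m - _ m) diffop_act_euler.
    by rewrite (fps_sum_degree a_gt0) // -[X in _ - X]E mulr_natr subrr.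
  rewrite eqE; split=> [[Z1 E] m|E].
    rewrite /Phi; have [->//|m1] := eqVneq m mone.
    by rewrite -E mulfK // pnatr_eq0 wdeg_eq0.
  split=> [|m]; first by rewrite E /Phi eqxx.
  (* At [mone] the equation reads 0 = 0: the weight is 0 and the sum is empty. *)
  have [->|m1] := eqVneq m mone; first by rewrite /rhs wdeg1 mulr0 big_geq.
  by rewrite [in LHS]E /Phi (negPf m1) mulfVK // pnatr_eq0 wdeg_eq0.
have [|Z [ZE Zuniq]] := @graded_recursion _ _ (wdeg a) 0 Phi.
  move=> f g m fg; rewrite /Phi; suff -> : rhs f m = rhs g m by [].
  apply: eq_big_nat => k /andP[k0 km].
  suff -> : hcomp a (wdeg a m - k) f = hcomp a (wdeg a m - k) g by [].
  apply/funext => m'; rewrite /hcomp.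
  case: (wdeg a m' =P (wdeg a m - k)%N) => // m'E; apply: fg.
  (* The strict decrease uses both [0 < k] and [0 < wdeg a m]; the latter follows from
     [k <= wdeg a m]. *)
  by rewrite m'E ltn_subrL k0 (leq_trans k0).
by exists Z; split=> [|Z' /PhiP]; [exact/PhiP|exact: Zuniq].
Qed.
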